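(* Let $K$ be a field, let $n\ge 2$ and $1\le a<n$ be integers, and let $t=\gcd(2n,a)$. Let $G=C_{2n}(a,n)$ be the cubic circulant graph, and let $I(G)\subset K[V(G)]$ be its edge ideal. (a) If $\frac{2n}{t}$ is even, then $$\operatorname{sdepth}\big(K[V(G)]/I(G)\big)\ge\begin{cases}\left\lceil\frac{n}{2t}\right\rceil\cdot t, & \text{if } \frac{n}{t}\equiv 1 \pmod 4,\\[1ex] \left\lceil\frac{n-t}{2t}\right\rceil\cdot t, & \text{otherwise.}\end{cases}$$ (b) If $\frac{2n}{t}$ is odd, then $$\operatorname{sdepth}\big(K[V(G)]/I(G)\big)\ge\begin{cases}\left\lceil\frac{2n-t}{2t}\right\rceil\cdot \frac{t}{2}, & \text{if } \frac{2n}{t}\equiv 1 \pmod 4,\\[1ex] \left\lceil\frac{n}{t}\right\rceil\cdot \frac{t}{2}, & \text{if } \frac{2n}{t}\equiv 3 \pmod 4.\end{cases}$$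
   Context: For a finite simple graph $G$, $K[V(G)]$ is the polynomial ring over $K$ whose variables are the vertices of $G$, and the edge ideal is $I(G)=(uv : \{u,v\}\in E(G))$. For $q\ge 2$ and a subset $\mathbb{S}\subseteq\{1,\dots,\lfloor q/2\rfloor\}$, the circulant graph $C_q(\mathbb{S})$ is the graph on vertices $x_1,\dots,x_q$ in which $\{x_i,x_j\}$ ($i\neq j$) is an edge if and only if $|i-j|\in \mathbb{S}$ or $q-|i-j|\in \mathbb{S}$; $C_{2n}(a,n)$ denotes $C_{2n}(\{a,n\})$. Stanley depth: let $S=K[x_1,\dots,x_q]$ and let $M$ be a finitely generated $\mathbb{Z}^q$-graded $S$-module. For a homogeneous $u\in M$ and $Z\subseteq\{x_1,\dots,x_q\}$, let $uK[Z]$ be the $K$-subspace of $M$ generated by all $uy$ with $y$ a monomial in $K[Z]$; it is a Stanley space of dimension $|Z|$ if it is a free $K[Z]$-module. A Stanley decomposition of $M$ is a decomposition of the $K$-vector space $M$ as a finite direct sum of Stanley spaces $\mathcal{D}: M=\bigoplus_{j=1}^m u_jK[Z_j]$; $\operatorname{sdepth}(\mathcal{D})=\min_j|Z_j|$, and $\operatorname{sdepth}(M)$ is the maximum of $\operatorname{sdepth}(\mathcal{D})$ over all Stanley decompositions $\mathcal{D}$ of $M$. *)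

(* Defs.v *)
From HB Require Import structures.
From mathcomp Require Import all_boot all_order all_algebra.
From mathcomp Require Import generic_quotient ring_quotient boolp.
From mathcomp.multinomials Require Import mpoly.

Set Implicit Arguments.
Unset Strict Implicit.
Unset Printing Implicit Defensive.

Import Order.TTheory GRing.Theory Num.Theory.

Local Open Scope ring_scope.
Local Open Scope quotient_scope.

Record sgraph (q : nat) := SGraph {
  adj :> rel 'I_q;
  adj_sym : ssrbool.symmetric adj;
  adj_irrefl : irreflexive adj
}.

Section Circulant.
Variables (q : nat) (S : seq nat).

(* The vertices x_1, ..., x_q are numbered from 0 here; only the differences
   of the indices matter. *)
Definition circulant_adj : rel 'I_q := fun i j =>
  (i != j) && ((`|i - j|%N \in S) || ((q - `|i - j|)%N \in S)).

Lemma circulant_adj_sym : ssrbool.symmetric circulant_adj.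
Proof. by move=> i j; rewrite /circulant_adj eq_sym distnC. Qed.

Lemma circulant_adj_irrefl : irreflexive circulant_adj.
Proof. by move=> i; rewrite /circulant_adj eqxx. Qed.

Definition circulant : sgraph q :=
  SGraph circulant_adj_sym circulant_adj_irrefl.

End Circulant.

Section Stanley.
Variables (K : fieldType) (q : nat).
Local Notation S := {mpoly K[q]}.
Local Notation degree := {ffun 'I_q -> int}.

Definition mnm_degree (m : 'X_{1..q}) : degree := [ffun i => (m i)%:Z].

Record multigraded := MultiGraded {
  mg_mod :> lmodType S;
  mg_comp : degree -> mg_mod -> Prop;
  mg_comp0 : forall a, mg_comp a 0;
  mg_compD : forall a x y, mg_comp a x -> mg_comp a y -> mg_comp a (x + y);
  mg_compZ : forall a (c : K) x, mg_comp a x -> mg_comp a (c%:MP *: x);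
  mg_compX : forall a (m : 'X_{1..q}) x,
    mg_comp a x -> mg_comp (a + mnm_degree m) ('X_[m] *: x);
  mg_span : forall x, exists (s : seq degree) (f : degree -> mg_mod),
    (forall a, mg_comp a (f a)) /\ x = \sum_(a <- s) f a;
  mg_indep : forall (s : seq degree) (f : degree -> mg_mod), uniq s ->
    (forall a, mg_comp a (f a)) -> \sum_(a <- s) f a = 0 ->
    forall a, a \in s -> f a = 0;
  mg_fingen : exists g : seq mg_mod, forall x, exists c : 'I_(size g) -> S,
    x = \sum_i c i *: g`_i
}.

(* Membership in the subring K[Z] of S. *)
Definition in_subpoly (Z : {set 'I_q}) (p : S) : Prop :=
  forall (m : 'X_{1..q}) i, m \in msupp p -> m i != 0%N -> i \in Z.

Section Module.
Variable M : multigraded.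

Definition homogeneous (u : M) : Prop := exists a, mg_comp a u.

(* Membership in u K[Z]: the elements p *: u with p in K[Z] are exactly the
   K-linear combinations of the y *: u with y a monomial in K[Z]. *)
Definition in_stanley (u : M) (Z : {set 'I_q}) (x : M) : Prop :=
  exists2 p : S, in_subpoly Z p & x = p *: u.

(* u K[Z] is free over K[Z], with basis u. *)
Definition is_stanley_space (u : M) (Z : {set 'I_q}) : Prop :=
  homogeneous u /\ forall p : S, in_subpoly Z p -> p *: u = 0 -> p = 0.

Record stanley_decomposition := StanleyDecomposition {
  sd_size : nat;
  sd_gen : 'I_sd_size -> M;
  sd_vars : 'I_sd_size -> {set 'I_q};
  sd_space : forall j, is_stanley_space (sd_gen j) (sd_vars j);
  sd_direct : forall x : M, exists! f : {ffun 'I_sd_size -> M},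
    (forall j, in_stanley (sd_gen j) (sd_vars j) (f j)) /\ x = \sum_j f j
}.

(* The default value q of the minimum is an upper bound of all the #|Z_j|; it
   only matters for the empty decomposition of the zero module. *)
Definition decomposition_sdepth (D : stanley_decomposition) : nat :=
  \big[minn/q]_(j < sd_size D) #|sd_vars j|.

(* The maximum can be restricted to d <= q since decomposition_sdepth D <= q. *)
Definition sdepth : nat :=
  \max_(d < q.+1 |
    `[< exists D : stanley_decomposition, decomposition_sdepth D = d >]) d.

End Module.
End Stanley.

Section EdgeIdeal.
Variables (K : fieldType) (q : nat) (G : sgraph q).
Local Notation S := {mpoly K[q]}.

Definition edge_ideal : {pred S} := fun p =>
  `[< exists c : 'I_q -> 'I_q -> S,
        p = \sum_i \sum_(j | G i j) c i j * ('X_i * 'X_j) >].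

Lemma edge_idealP (p : S) :
  reflect (exists c : 'I_q -> 'I_q -> S,
             p = \sum_i \sum_(j | G i j) c i j * ('X_i * 'X_j))
          (p \in edge_ideal).
Proof. exact: asboolP. Qed.

Lemma edge_ideal_idealr : idealr_closed edge_ideal.
Proof.
split.
- apply/edge_idealP; exists (fun _ _ => 0).
  by rewrite big1 // => i _; rewrite big1 // => j _; rewrite mul0r.
- apply/negP => /edge_idealP [c] /(congr1 (meval (fun _ => 0))).
  rewrite meval1 raddf_sum big1 /=; first by move/eqP; rewrite oner_eq0.
  move=> i _; rewrite raddf_sum big1 //= => j _.
  by rewrite !mevalM !mevalXU mul0r mulr0.
- move=> a x y /edge_idealP [c ->] /edge_idealP [d ->]; apply/edge_idealP.
  exists (fun i j => a * c i j + d i j).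
  rewrite mulr_sumr -big_split /=; apply: eq_bigr => i _ /=.
  rewrite mulr_sumr -big_split /=; apply: eq_bigr => j _ /=.
  by rewrite mulrDl -(mulrA a).
Qed.

HB.instance Definition _ := isIdealr.Build S edge_ideal edge_ideal_idealr.

Definition edge_ring : Type := {ideal_quot edge_ideal}.

HB.instance Definition _ := GRing.ComNzRing.on edge_ring.

Definition edge_pi (p : S) : edge_ring := \pi_({ideal_quot edge_ideal}) p.

Lemma edge_pi0 : edge_pi 0 = 0. Proof. exact: raddf0. Qed.
Lemma edge_piD : {morph edge_pi : x y / x + y}. Proof. exact: raddfD. Qed.
Lemma edge_piM : {morph edge_pi : x y / x * y}. Proof. exact: rmorphM. Qed.
Lemma edge_pi1 : edge_pi 1 = 1. Proof. exact: rmorph1. Qed.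
Lemma edge_pi_sum I (r : seq I) (F : I -> S) :
  edge_pi (\sum_(i <- r) F i) = \sum_(i <- r) edge_pi (F i).
Proof. exact: raddf_sum. Qed.

Lemma edge_piP (x : edge_ring) : exists p, x = edge_pi p.
Proof. by exists (repr (x : {ideal_quot edge_ideal})); rewrite /edge_pi reprK. Qed.

Lemma edge_pi_eq0 (p : S) : (edge_pi p == 0) = (p \in edge_ideal).
Proof.
by rewrite -edge_pi0 /edge_pi; rewrite -Quotient.idealrBE subr0.
Qed.

Definition edge_scale (p : S) (x : edge_ring) : edge_ring := edge_pi p * x.

Lemma edge_scaleA p r x :
  edge_scale p (edge_scale r x) = edge_scale (p * r) x.
Proof. by rewrite /edge_scale edge_piM mulrA. Qed.
Lemma edge_scale1 : left_id 1 edge_scale.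
Proof. by move=> x; rewrite /edge_scale edge_pi1 mul1r. Qed.
Lemma edge_scaleDr : right_distributive edge_scale +%R.
Proof. by move=> p x y; rewrite /edge_scale mulrDr. Qed.
Lemma edge_scaleDl x : {morph edge_scale^~ x : p r / p + r}.
Proof. by move=> p r; rewrite /edge_scale edge_piD mulrDl. Qed.

HB.instance Definition _ := GRing.Zmodule_isLmodule.Build S edge_ring
  edge_scaleA edge_scale1 edge_scaleDr edge_scaleDl.

Lemma edge_scaleE (p r : S) : p *: edge_pi r = edge_pi (p * r).
Proof. by rewrite edge_piM. Qed.

(* The component of degree a is the image of the component of degree a of S. *)
Definition edge_comp (a : {ffun 'I_q -> int}) (x : edge_ring) : Prop :=
  exists2 p : S, (forall m, m \in msupp p -> mnm_degree m = a)
               & x = edge_pi p.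

Lemma edge_comp0 a : edge_comp a 0.
Proof. by exists 0; [move=> m; rewrite msupp0 | rewrite edge_pi0]. Qed.

Lemma edge_compD a x y :
  edge_comp a x -> edge_comp a y -> edge_comp a (x + y).
Proof.
move=> [p hp ->] [r hr ->]; exists (p + r); last by rewrite edge_piD.
by move=> m /msuppD_le; rewrite mem_cat => /orP [/hp|/hr].
Qed.

Lemma edge_compX a (m : 'X_{1..q}) x :
  edge_comp a x -> edge_comp (a + mnm_degree m) ('X_[m] *: x).
Proof.
move=> [p hp ->]; exists ('X_[m] * p); last by rewrite edge_scaleE.
move=> k; rewrite mulrC (perm_mem (msuppMX _ _)) => /mapP [l /hp <- ->].
by apply/ffunP=> i; rewrite !ffunE mnmDE PoszD addrC.
Qed.

Lemma edge_compZ a (c : K) x : edge_comp a x -> edge_comp a (c%:MP *: x).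
Proof.
move=> [p hp ->]; exists (c%:MP * p); last by rewrite edge_scaleE.
by move=> m; rewrite mul_mpolyC => /msuppZ_le /hp.
Qed.

Lemma mnm_degree_inj : injective (@mnm_degree q).
Proof.
by move=> m k /ffunP e; apply/mnmP => i; have := e i; rewrite !ffunE => -[].
Qed.

Lemma edge_ideal_mcoeff (p : S) (m : 'X_{1..q}) :
  p \in edge_ideal -> p@_m *: 'X_[m] \in edge_ideal.
Proof.
move=> /edge_idealP [c ->]; rewrite raddf_sum scaler_suml; apply: rpred_sum => i _.
rewrite raddf_sum scaler_suml; apply: rpred_sum => j ij /=.
rewrite -mpolyXD {1}[c i j]mpolyE mulr_suml raddf_sum scaler_suml.
apply: rpred_sum => k _ /=; rewrite -scalerAl -mpolyXD mcoeffZ mcoeffX.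
case: eqP => [<-|_]; last by rewrite mulr0 scale0r rpred0.
rewrite mulr1 mpolyXD -mul_mpolyC mulrA.
apply: idealMr; apply/edge_idealP.
exists (fun i' j' => ((i' == i) && (j' == j))%:R).
rewrite (bigD1 i) //= (bigD1 j) //= !eqxx mul1r mpolyXD.
rewrite big1 ?addr0 => [|j' /andP [_ /negbTE ->]]; last by rewrite mul0r.
rewrite big1 ?addr0 // => i' /negbTE ne.
by rewrite big1 // => j' _; rewrite ne mul0r.
Qed.

Lemma edge_span (x : edge_ring) :
  exists (s : seq {ffun 'I_q -> int}) (f : {ffun 'I_q -> int} -> edge_ring),
    (forall a, edge_comp a (f a)) /\ x = \sum_(a <- s) f a.
Proof.
have [p ->] := edge_piP x.
pose g a : S := \sum_(m <- msupp p | mnm_degree m == a) p@_m *: 'X_[m].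
exists [seq mnm_degree m | m <- msupp p], (fun a => edge_pi (g a)); split.
  move=> a; exists (g a) => // m; rewrite mcoeff_msupp /g raddf_sum /=.
  apply: contraNeq => ne; rewrite big1 // => k /eqP ka.
  rewrite mcoeffZ mcoeffX; case: eqP => [km|]; last by rewrite mulr0.
  by rewrite -km ka eqxx in ne.
rewrite big_map -edge_pi_sum {1}[p]mpolyE; congr edge_pi.
apply: eq_big_seq => m mp; rewrite /g.
rewrite big_mkcond (bigD1_seq m) ?msupp_uniq //= eqxx.
rewrite big1 ?addr0 // => k km; case: eqP => // /mnm_degree_inj e.
by rewrite e eqxx in km.
Qed.

Lemma edge_indep (s : seq {ffun 'I_q -> int})
    (f : {ffun 'I_q -> int} -> edge_ring) :
  uniq s -> (forall a, edge_comp a (f a)) -> \sum_(a <- s) f a = 0 ->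
  forall a, a \in s -> f a = 0.
Proof.
move=> us hf.
have /boolp.choice [g hg] : forall a, exists p : S,
    (forall m, m \in msupp p -> mnm_degree m = a) /\ f a = edge_pi p.
  by move=> a; have [p] := hf a; exists p.
under eq_bigr => a _ do rewrite (hg a).2.
rewrite -edge_pi_sum => /eqP; rewrite edge_pi_eq0 => sI a as_.
rewrite (hg a).2; apply/eqP; rewrite edge_pi_eq0 [g a]mpolyE big_seq.
apply: rpred_sum => m mga.
suff <- : (\sum_(b <- s) g b)@_m = (g a)@_m by exact: edge_ideal_mcoeff.
rewrite raddf_sum (bigD1_seq a) //= big1 ?addr0 // => b ba.
apply: memN_msupp_eq0; apply: contraNN ba => /(hg b).1 <-.
by rewrite ((hg a).1 _ mga).
Qed.

Lemma edge_fingen : exists g : seq edge_ring, forall x,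
  exists c : 'I_(size g) -> S, x = \sum_i c i *: g`_i.
Proof.
exists [:: edge_pi 1] => x; have [p ->] := edge_piP x.
by exists (fun=> p); rewrite big_ord1 edge_scaleE mulr1.
Qed.

(* K[V(G)] / I(G) as a multigraded K[V(G)]-module. *)
Definition edge_quotient : multigraded K q :=
  @MultiGraded K q edge_ring edge_comp edge_comp0 edge_compD edge_compZ
    edge_compX edge_span edge_indep edge_fingen.

End EdgeIdeal.

(* Main.v *)
Require Import Defs.
From mathcomp Require Import all_boot all_order all_algebra.
From mathcomp Require Import boolp zify ring.
From mathcomp.multinomials Require Import mpoly.

(** The monomials outside I(G) are those supported on an independent set of G.
    A partition of the independent sets into intervals [A, B] therefore gives a
    Stanley decomposition of K[V(G)]/I(G) into the spaces x_A K[B], and the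
    Stanley depth is at least the least #|B| (the easy half of the theorem of
    Herzog, Vladoiu and Zheng, [sdepth_interval_partition]).

    Such partitions are built by branching on a vertex v: the independent sets
    that contain v are v joined to the independent sets of G minus the closed
    neighbourhood of v, the others are the independent sets of G - v. So a
    bound d on both G - N[v] (with one added for v) and G - v is a bound on G,
    and an isolated vertex adds one. The predicate [branching] records the
    bounds obtained in this way; it is additive on disjoint unions and carried
    along isomorphisms.

    Let g = gcd(a, n) and m = n / g. The map (c, r, s) -> c + a r + n s shows
    that C_2n(a, n) is a disjoint union of g cubic graphs, each a ladder with m
    rungs whose last rung is glued to the first one, straight (a prism) or with
    a twist (a Moebius ladder) according to the parity of a / g. That parity and
    the value of g are exactly what the parity of 2n / gcd(2n, a) decides.

    It remains to bound one closed ladder. Branching on one vertex of the first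
    rung and on a vertex of the next rung, on the other side, leaves only open
    ladders carrying a pendant vertex at one or both ends. For these, branching
    on the neighbour of the first pendant vertex gives a ladder of the same kind,
    with the pendant vertex on the other side and one or two rungs fewer. The
    resulting recursion has the solution stated in [branching_strip_open] and
    [branching_strip_closed]: about half the number of rungs, but with jumps that
    depend on the number of rungs modulo 4 and on whether the two pendant
    vertices lie on the same side. These jumps are where the congruences modulo 4
    of the theorem come from. *)

Set Implicit Arguments.
Unset Strict Implicit.
Unset Printing Implicit Defensive.

(** * Branching on vertices *)

(** [branching e s d] certifies that the subgraph induced by e on the entries of
    s has Stanley depth at least d. Being generated by rules, it can be carried
    over to another vertex type by induction on the certificate, without
    transporting partitions.
    In [branching_vertex] the first premise is one lower than the second: a part
    with v gains the vertex v, a part without v gains nothing. *)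
Inductive branching (T : eqType) (e : rel T) : seq T -> nat -> Prop :=
| branching_nil : branching e [::] 0
| branching_eqmem s s' d : s =i s' -> branching e s d -> branching e s' d
| branching_leq s d d' : d' <= d -> branching e s d -> branching e s d'
| branching_isolated v s d : v \notin s -> ~~ has (e v) s ->
    branching e s d -> branching e (v :: s) d.+1
| branching_vertex v s d : v \notin s ->
    branching e [seq x <- s | ~~ e v x] d -> branching e s d.+1 ->
    branching e (v :: s) d.+1.

Lemma branching_map (T T' : eqType) (e : rel T) (e' : rel T') (f : T -> T') s d :
  {in s &, injective f} -> {in s &, forall x y, e' (f x) (f y) = e x y} ->
  branching e s d -> branching e' (map f s) d.
Proof.
move=> + + H; elim: H => {s d} [|s s' d ss' _ IH|s d d' dd' _ IH|v s d vs ev _ IH|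
  v s d vs _ IH1 _ IH2] /= fi fe.
- exact: branching_nil.
- apply: (@branching_eqmem _ _ (map f s)); first exact: eq_mem_map.
  by apply: IH => x y; rewrite !ss'; [apply: fi | apply: fe].
- by apply: branching_leq dd' _; apply: IH.
- have sub x : x \in s -> x \in v :: s by rewrite inE orbC => ->.
  apply: branching_isolated; last first.
  + by apply: IH => x y /sub xs /sub; [apply: fi | apply: fe].
  + rewrite has_map; apply: contra ev => /hasP [x xs /= ex]; apply/hasP; exists x => //.
    by rewrite -fe ?mem_head ?sub.
  apply: contra vs => /mapP [x xs vx].
  by rewrite (fi v x) ?mem_head ?sub.
- have sub x : x \in s -> x \in v :: s by rewrite inE orbC => ->.
  apply: branching_vertex.
  + apply: contra vs => /mapP [x xs vx].
    by rewrite (fi v x) ?mem_head ?sub.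
  + rewrite filter_map (@eq_in_filter _ _ (fun x => ~~ e v x)); last first.
      by move=> x xs /=; rewrite fe ?mem_head ?sub.
    by apply: IH1 => x y; rewrite !mem_filter => /andP [_ /sub xs] /andP [_ /sub ys];
       [apply: fi | apply: fe].
  + by apply: IH2 => x y /sub xs /sub; [apply: fi | apply: fe].
Qed.

(** Follows the certificate of the first graph, adding the second graph to every
    induced subgraph that occurs in it; the certificate of the second one
    replaces the empty leaf. *)
Lemma branching_cat (T : eqType) (e : rel T) s1 s2 d1 d2 :
  {in s1 & s2, forall x y, (x != y) && ~~ e x y} ->
  branching e s1 d1 -> branching e s2 d2 -> branching e (s1 ++ s2) (d1 + d2).
Proof.
move=> + H H2; elim: H => {s1 d1} [|s s' d ss' _ IH|s d d' dd' _ IH|v s d vs ev _ IH|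
  v s d vs _ IH1 _ IH2] /= sep.
- by [].
- apply: branching_eqmem (IH _); last by move=> x y; rewrite ss'; apply: sep.
  by move=> x; rewrite !mem_cat ss'.
- by apply: branching_leq (IH sep); rewrite leq_add2r.
- have sub x : x \in s -> x \in v :: s by rewrite inE orbC => ->.
  rewrite addSn; apply: branching_isolated.
  + rewrite mem_cat negb_or vs; apply/negP => vs2.
    by have := sep v v (mem_head _ _) vs2; rewrite eqxx.
  + rewrite has_cat negb_or ev; apply/hasPn => y ys.
    by have /andP[] := sep v y (mem_head _ _) ys.
  + by apply: IH => x y /sub; apply: sep.
- have sub x : x \in s -> x \in v :: s by rewrite inE orbC => ->.
  rewrite addSn; apply: branching_vertex.
  + rewrite mem_cat negb_or vs; apply/negP => vs2.
    by have := sep v v (mem_head _ _) vs2; rewrite eqxx.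
  + rewrite filter_cat [X in _ ++ X](_ : _ = s2).
      by apply: IH1 => x y; rewrite mem_filter => /andP [_ /sub]; apply: sep.
    apply/all_filterP/allP => y ys.
    by have /andP[] := sep v y (mem_head _ _) ys.
  + by rewrite -addSn; apply: IH2 => x y /sub; apply: sep.
Qed.

(** * From vertex branchings to interval partitions *)

Section Intervals.
Variables (T : finType) (e : rel T).
Hypothesis esym : ssrbool.symmetric e.
Hypothesis eirr : irreflexive e.

Definition independent (X : {set T}) := [forall x in X, forall y in X, ~~ e x y].

Lemma independentP (X : {set T}) :
  reflect {in X &, forall x y, ~~ e x y} (independent X).
Proof.
apply: (iffP forall_inP) => [H x y xX yX | H x xX].
  by have /forall_inP := H x xX; apply.
by apply/forall_inP => y; apply: H.
Qed.

Definition within (AB : {set T} * {set T}) (X : {set T}) :=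
  (AB.1 \subset X) && (X \subset AB.2).

Definition interval_partition (s : seq T) d (P : seq ({set T} * {set T})) :=
  (forall AB, AB \in P -> [/\ AB.1 \subset AB.2, AB.2 \subset s,
      independent AB.2 & d <= #|AB.2|])
  /\ (forall X : {set T}, independent X -> X \subset s ->
       count (within^~ X) P = 1).

Lemma independentU1 v (B : {set T}) :
  independent B -> {in B, forall x, ~~ e v x} -> independent (v |: B).
Proof.
move=> /independentP iB vB; apply/independentP => x y /setU1P [->|xB] /setU1P [->|yB].
- by rewrite eirr.
- exact: vB.
- by rewrite esym vB.
- exact: iB.
Qed.

(** An isolated vertex v is added to the top of every interval. When branching on
    v, it is added to both ends of the intervals of the neighbour-free part,
    which then hold the sets with v, and the intervals of the rest of the graph
    hold the sets without v. *)
Lemma branching_intervals s d : branching e s d ->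
  exists P, interval_partition s d P.
Proof.
elim=> {s d} [|s s' d ss' _ [P [P1 P2]]|s d d' dd' _ [P [P1 P2]]|v s d vs ev _ [P [P1 P2]]|
  v s d vs _ [P [P1 P2]] _ [Q [Q1 Q2]]].
- exists [:: (set0, set0)]; split.
    move=> AB; rewrite inE => /eqP ->; split; rewrite ?sub0set //.
    + by apply/subsetP => x; rewrite inE.
    + by apply/independentP => x y; rewrite inE.
  move=> X _ /subsetP X0; rewrite /= /within /= sub0set.
  by have -> : X \subset set0 by apply/subsetP => x /X0.
- exists P; split => [AB /P1|X iX]; rewrite -!(eq_subset_r ss') //; exact: P2.
- by exists P; split => // AB /P1 [? ? ? /(leq_trans dd')].
- have nv AB : AB \in P -> v \notin AB.2.
    by move=> /P1 [_ /subsetP sB _ _]; apply: contra vs => /sB.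
  exists [seq (AB.1, v |: AB.2) | AB <- P]; split.
    move=> _ /mapP [AB ABP ->] /=; have [h1 h2 h3 h4] := P1 _ ABP; split.
    + by rewrite subsetU // h1 orbT.
    + apply/subsetP => x /setU1P [->|/(subsetP h2)]; rewrite inE ?eqxx // => ->.
      by rewrite orbT.
    + apply: independentU1 => // x /(subsetP h2) xs.
      by move/hasPn: ev; apply.
    + by rewrite cardsU1 nv.
  move=> X iX Xs; rewrite count_map -(P2 (X :\ v)); first last.
  + apply/subsetP => x; rewrite !inE => /andP [xv /(subsetP Xs)].
    by rewrite inE (negbTE xv).
  + by apply/independentP => x y; rewrite !inE => /andP [_ xX] /andP [_ yX];
       move/independentP: iX; apply.
  apply: eq_in_count => AB ABP; rewrite /within /= subsetD1 -subDset.
  have -> // : v \notin AB.1 by apply: contra (nv _ ABP) => /(subsetP (let: And4 h _ _ _ := P1 _ ABP in h)).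
  by rewrite andbT.
- have nv AB : AB \in P -> v \notin AB.2.
    move=> /P1 [_ /subsetP sB _ _]; apply: contra vs => /sB.
    by rewrite mem_filter => /andP [].
  exists ([seq (v |: AB.1, v |: AB.2) | AB <- P] ++ Q); split.
    move=> AB; rewrite mem_cat => /orP [/mapP [{}AB ABP ->]|/Q1 [h1 h2 h3 h4]] /=.
      have [h1 h2 h3 h4] := P1 _ ABP; split.
      + exact: setUS.
      + apply/subsetP => x /setU1P [->|/(subsetP h2)]; rewrite inE ?eqxx //.
        by rewrite mem_filter => /andP [_ ->]; rewrite orbT.
      + apply: independentU1 => // x /(subsetP h2).
        by rewrite mem_filter => /andP [].
      + by rewrite cardsU1 nv.
    split=> //; apply/subsetP => x /(subsetP h2) xs; by rewrite inE xs orbT.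
  move=> X iX Xs; rewrite count_cat count_map.
  have [vX|vX] := boolP (v \in X).
    rewrite [X in _ + X](_ : _ = 0) ?addn0; last first.
      apply/eqP; rewrite eqn0Ngt -has_count; apply/hasPn => AB /Q1 [_ h2 _ _].
      by apply: contra vs => /andP [_ /subsetP/(_ _ vX)/(subsetP h2)].
    rewrite -(P2 (X :\ v)); first last.
    + apply/subsetP => x; rewrite !inE mem_filter => /andP [xv xX].
      have := subsetP Xs _ xX; rewrite inE (negbTE xv) /= => ->.
      by rewrite andbT; move/independentP: iX; apply.
    + by apply/independentP => x y; rewrite !inE => /andP [_ xX] /andP [_ yX];
         move/independentP: iX; apply.
    apply: eq_in_count => AB ABP; rewrite /within /= subUset sub1set vX /= subsetD1 -subDset.
    have -> // : v \notin AB.1 by apply: contra (nv _ ABP) => /(subsetP (let: And4 h _ _ _ := P1 _ ABP in h)).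
    by rewrite andbT.
  rewrite [X in X + _](_ : _ = 0) ?add0n.
    apply: Q2 => //; apply/subsetP => x xX; have := subsetP Xs _ xX.
    by rewrite inE; case: eqP => // xv; rewrite -xv xX in vX.
  apply/eqP; rewrite eqn0Ngt -has_count; apply/hasPn => AB ABP /=.
  by rewrite /within /= subUset sub1set (negbTE vX).
Qed.

End Intervals.

(** * From interval partitions to Stanley decompositions *)

Section StanleyOfIntervals.
Import GRing.Theory.
Local Open Scope ring_scope.
Variables (K : fieldType) (q : nat) (G : sgraph q).
Local Notation S := {mpoly K[q]}.
Local Notation vset := {set 'I_q}.

Definition mnm_supp (m : 'X_{1..q}) : vset := [set i | m i != 0%N].

(** The exponent of the squarefree monomial x_A. *)
Definition mnm_of_set (A : vset) : 'X_{1..q} := [multinom (i \in A : nat) | i < q].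

Lemma mnm_supp_of_set A : mnm_supp (mnm_of_set A) = A.
Proof. by apply/setP => i; rewrite inE mnmE; case: (i \in A). Qed.

Lemma mnm_suppD m k : mnm_supp (m + k)%MM = mnm_supp m :|: mnm_supp k.
Proof. by apply/setP => i; rewrite !inE mnmDE addn_eq0 negb_and. Qed.

Lemma mnm_of_set_le (A : vset) m : A \subset mnm_supp m -> (mnm_of_set A <= m)%MM.
Proof.
move=> /subsetP sA; apply/mnm_lepP => i; rewrite mnmE.
by case: (boolP (i \in A)) => // /sA; rewrite inE lt0n.
Qed.

Lemma edge_ideal_dependent m : ~~ independent G (mnm_supp m) ->
  ('X_[m] : S) \in edge_ideal G.
Proof.
move=> /forall_inPn [i]; rewrite inE => mi /forall_inPn [j].
rewrite inE negbK => mj Gij.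
have ij : i != j by apply: contraTneq Gij => ->; rewrite adj_irrefl.
have le : (U_(i) + U_(j) <= m)%MM.
  apply/mnm_lepP => k; rewrite mnmDE !mnm1E.
  have [ik|_] := eqVneq i k; have [jk|_] := eqVneq j k => //=.
  - by rewrite ik jk eqxx in ij.
  - by rewrite addn0 lt0n -ik.
  - by rewrite add0n lt0n -jk.
rewrite -(submK le) mpolyXD; apply: idealMr; rewrite mpolyXD.
apply/edge_idealP; exists (fun i' j' => ((i' == i) && (j' == j))%:R).
rewrite (bigD1 i) //= (bigD1 j) //= !eqxx mul1r.
rewrite big1 ?addr0 => [|j' /andP [_ /negbTE ->]]; last by rewrite mul0r.
rewrite big1 ?addr0 // => i' /negbTE ne.
by rewrite big1 // => j' _; rewrite ne mul0r.
Qed.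

Lemma edge_ideal_independent (p : S) m :
  p \in edge_ideal G -> independent G (mnm_supp m) -> p@_m = 0.
Proof.
move=> /edge_idealP [c ->] /independentP im.
rewrite raddf_sum big1 // => i _; rewrite raddf_sum big1 //= => j Gij.
apply: memN_msupp_eq0; rewrite -mpolyXD (perm_mem (msuppMX _ _)).
apply/mapP => -[k _ mE].
have /negP[] : ~~ G i j by apply: im; rewrite inE mE !mnmDE !mnm1E eqxx; lia.
exact: Gij.
Qed.

Variables (d : nat) (P : seq (vset * vset)).
Hypothesis partP : interval_partition G (enum 'I_q) d P.

Definition part (j : 'I_(size P)) := nth (set0, set0) P j.

Lemma partE j : [/\ (part j).1 \subset (part j).2, independent G (part j).2
  & (d <= #|(part j).2|)%N].
Proof. by have [|? ? ? ?] := partP.1 (part j); first exact: mem_nth. Qed.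

Lemma within_independent j X : within (part j) X -> independent G X.
Proof.
have [_ /independentP iB _] := partE j.
by move=> /andP [_ /subsetP XB]; apply/independentP => x y /XB xB /XB; apply: iB.
Qed.

Lemma part_unique X : independent G X ->
  exists j, forall k, within (part k) X = (k == j).
Proof.
move=> iX; have /(partP.2 X iX) : X \subset enum 'I_q.
  by apply/subsetP => x _; rewrite mem_enum.
rewrite -sum1_count (big_nth (set0, set0)) big_mkord sum1_card.
by move=> /mem_card1 [j Hj]; exists j => k; exact: (Hj k).
Qed.

Lemma part_injective j k X : within (part j) X -> within (part k) X -> j = k.
Proof.
move=> wj; have [l Hl] := part_unique (within_independent wj).
by move: wj; rewrite !Hl => /eqP -> /eqP ->.
Qed.

(** The pieces live on disjoint sets of monomials, and no monomial of any piece
    lies in the monomial ideal I(G); this gives both the freeness and the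
    directness of the decomposition. *)
Lemma edge_ideal_direct (r : 'I_(size P) -> S) :
  (forall j m, m \in msupp (r j) -> within (part j) (mnm_supp m)) ->
  \sum_j r j \in edge_ideal G -> forall j, r j = 0.
Proof.
move=> wr rI j; apply/mpolyP => m; rewrite mcoeff0.
have [mr|] := boolP (m \in msupp (r j)); last exact: memN_msupp_eq0.
have wj := wr _ _ mr.
rewrite -(edge_ideal_independent rI (within_independent wj)).
rewrite raddf_sum (bigD1 j) //= big1 ?addr0 // => k kj.
apply: memN_msupp_eq0; apply: contra kj => /wr wk.
by rewrite (part_injective wk wj).
Qed.

Lemma within_stanley j (p : S) m : in_subpoly (part j).2 p ->
  m \in msupp (p * 'X_[mnm_of_set (part j).1]) -> within (part j) (mnm_supp m).
Proof.
move=> hp; rewrite (perm_mem (msuppMX _ _)) => /mapP [k kp ->].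
have [AB _ _] := partE j.
rewrite /within mnm_suppD mnm_supp_of_set subsetUl subUset AB /=.
by apply/subsetP => i; rewrite inE => ki; apply: hp kp ki.
Qed.

Definition part_gen j : edge_quotient K G := edge_pi G 'X_[mnm_of_set (part j).1].

Lemma part_space j : is_stanley_space (part_gen j) (part j).2.
Proof.
split.
  exists (mnm_degree (mnm_of_set (part j).1)); exists 'X_[mnm_of_set (part j).1] => // m.
  by rewrite msuppX inE => /eqP ->.
move=> p hp; rewrite [_ *: _]edge_scaleE => /eqP; rewrite edge_pi_eq0 => pI.
have /eqP : p * 'X_[mnm_of_set (part j).1] = 0.
  apply/mpolyP => m; rewrite mcoeff0.
  have [mr|] := boolP (m \in msupp (p * 'X_[mnm_of_set (part j).1])); last exact: memN_msupp_eq0.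
  exact: edge_ideal_independent pI (within_independent (within_stanley hp mr)).
rewrite mulf_eq0 => /orP [/eqP //|/eqP/(congr1 (mcoeff (mnm_of_set (part j).1)))].
by rewrite mcoeffX eqxx mcoeff0 => /eqP; rewrite oner_eq0.
Qed.

(** The part of p on the monomials that belong to the j-th interval, divided by
    the generator of the j-th Stanley space. *)
Definition part_coef (p : S) j : S :=
  \sum_(m <- msupp p | within (part j) (mnm_supp m))
    p@_m *: 'X_[m - mnm_of_set (part j).1].

Lemma part_coef_subpoly p j : in_subpoly (part j).2 (part_coef p j).
Proof.
move=> k i; rewrite mcoeff_msupp /part_coef raddf_sum /= => kp ki.
apply: contraNT kp => iB; rewrite big1 // => m /andP [_ /subsetP mB].
rewrite mcoeffZ mcoeffX; case: eqP => [km|]; last by rewrite mulr0.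
case/negP: iB; apply: mB; rewrite inE; apply: contra ki => /eqP mi.
by rewrite -km mnmBE mi sub0n.
Qed.

Lemma part_coefE p :
  edge_pi G p = \sum_j part_coef p j *: part_gen j.
Proof.
under eq_bigr => j _ do rewrite [_ *: _]edge_scaleE.
have e j : part_coef p j * 'X_[mnm_of_set (part j).1] =
    \sum_(m <- msupp p | within (part j) (mnm_supp m)) p@_m *: 'X_[m].
  rewrite mulr_suml; apply: eq_bigr => m /andP [Am _].
  by rewrite -scalerAl -mpolyXD submK // mnm_of_set_le.
under eq_bigr => j _ do rewrite e.
rewrite -edge_pi_sum (exchange_big_dep predT) //= {1}[p]mpolyE !edge_pi_sum.
apply: eq_bigr => m _; have [im|nm] := boolP (independent G (mnm_supp m)).
  have [j Hj] := part_unique im.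
  by rewrite (eq_bigl _ _ Hj) big_pred1_eq.
rewrite big_pred0 ?edge_pi0 => [|j]; last first.
  by apply: contraNF nm => /within_independent.
by apply/eqP; rewrite edge_pi_eq0 -mul_mpolyC idealMr // edge_ideal_dependent.
Qed.

Lemma part_direct (x : edge_quotient K G) :
  exists! f : {ffun 'I_(size P) -> edge_quotient K G},
    (forall j, in_stanley (part_gen j) (part j).2 (f j)) /\ x = \sum_j f j.
Proof.
have [p ->] := edge_piP x.
exists [ffun j => part_coef p j *: part_gen j]; split.
  split; last by rewrite part_coefE; apply: eq_bigr => j _; rewrite ffunE.
  by move=> j; rewrite ffunE; exists (part_coef p j) => //; exact: part_coef_subpoly.
move=> f [hf sumf].
have /boolp.choice [c hc] : forall j, exists c : S,
    in_subpoly (part j).2 c /\ f j = c *: part_gen j.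
  by move=> j; have [c] := hf j; exists c.
pose r j := (part_coef p j - c j) * 'X_[mnm_of_set (part j).1].
have r0 : forall j, r j = 0.
  apply: edge_ideal_direct => [j m|].
    apply: within_stanley => k i /msuppB_le; rewrite mem_cat => /orP [].
      exact: part_coef_subpoly.
    exact: (hc j).1.
  rewrite -edge_pi_eq0 edge_pi_sum.
  under eq_bigr => j _ do rewrite -edge_scaleE scalerBl.
  by rewrite sumrB -part_coefE sumf; under [X in _ - X]eq_bigr => j _ do rewrite -(hc j).2;
    rewrite subrr.
apply/ffunP => j; rewrite ffunE (hc j).2; apply/eqP.
by rewrite -subr_eq0 -scalerBl [_ *: _]edge_scaleE -/(r j) r0 edge_pi0.
Qed.

Definition part_decomposition : stanley_decomposition (edge_quotient K G) :=
  @StanleyDecomposition K q _ (size P) part_gen (fun j => (part j).2)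
    part_space part_direct.

Lemma sdepth_interval_partition : (d <= q)%N -> (d <= sdepth (edge_quotient K G))%N.
Proof.
move=> dq; pose D := part_decomposition.
have dD : (d <= decomposition_sdepth D)%N.
  rewrite /decomposition_sdepth; elim/big_ind: _ => // [x y dx dy|j _].
    by rewrite leq_min dx.
  by have [] := partE j.
have Dq : (decomposition_sdepth D < q.+1)%N.
  rewrite ltnS /decomposition_sdepth; elim/big_ind: _ => // [x y xq _|j _].
    by rewrite geq_min xq.
  by rewrite -[X in (_ <= X)%N](card_ord q) max_card.
apply: leq_trans dD _; rewrite /sdepth.
by apply: (@leq_bigmax_cond _ _ (fun d : 'I_q.+1 => (d : nat)) (Ordinal Dq));
  apply/asboolP; exists D.
Qed.

End StanleyOfIntervals.

Lemma branching_sdepth (K : fieldType) q (G : sgraph q) d :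
  d <= q -> branching G (enum 'I_q) d -> d <= sdepth (edge_quotient K G).
Proof.
move=> dq /(branching_intervals (@adj_sym _ G) (@adj_irrefl _ G)) [P partP].
exact: (sdepth_interval_partition K partP).
Qed.

(** * Ladders with pendant vertices *)

Section Ladder.

(** The two-sided ladder with infinitely many rungs; (r, s) is the end of the
    rung r on the side s. *)
Definition ladder : rel (nat * bool) := fun x y =>
  ((x.1 == y.1) && (x.2 != y.2)) ||
  ((x.2 == y.2) && ((y.1 == x.1.+1) || (x.1 == y.1.+1))).

Definition rungs i k : seq (nat * bool) :=
  [seq (r, t) | r <- iota i k, t <- [:: false; true]].

Lemma mem_rungs i k r t : ((r, t) \in rungs i k) = (i <= r < i + k).
Proof.
rewrite -mem_iota; apply/allpairsP/idP => [[[a b] /= [+ _ [-> _]]] //|ri].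
by exists (r, t); rewrite /= ri; case: t.
Qed.

(** The ladder on the k rungs after i, with a pendant vertex before its first
    rung on the side s, and pendant vertices after its last rung on the sides
    in E. *)
Definition strip i s k (E : seq bool) : seq (nat * bool) :=
  (i, s) :: rungs i.+1 k ++ [seq ((i + k).+1, t) | t <- E].

Lemma mem_strip i s k E r t : ((r, t) \in strip i s k E) =
  [|| (r == i) && (t == s), i < r <= i + k | (r == (i + k).+1) && (t \in E)].
Proof.
rewrite inE mem_cat mem_rungs addSn ltnS; congr [|| _, _ | _].
apply/mapP/andP => [[u uE [-> ->]]|[/eqP -> tE]]; first by rewrite eqxx.
by exists t.
Qed.

(** Branch on the neighbour (i+1, s) of the pendant vertex (i, s). Choosing it
    leaves (i+2, ~~ s) as a pendant vertex of the remaining rungs; dropping it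
    isolates (i, s), which adds one, and leaves (i+1, ~~ s) as a pendant vertex. *)
Lemma branching_strip_step i s k E d :
  branching ladder (if k is k'.+1 then strip i.+2 (~~ s) k' E
                    else [seq (i.+2, t) | t <- E & t == ~~ s]) d ->
  branching ladder (strip i.+1 (~~ s) k E) d ->
  branching ladder (strip i s k.+1 E) d.+1.
Proof.
move=> Hin Hout.
apply: (@branching_eqmem _ _ ((i.+1, s) :: (i, s) :: strip i.+1 (~~ s) k E)).
  move=> [r t]; rewrite 2!inE !mem_strip !xpair_eqE addSnnS.
  case: (t \in E); case: s t {Hin Hout} => -[]; lia.
apply: branching_vertex.
- rewrite inE mem_strip xpair_eqE; case: (s \in E); case: s {Hin Hout} => /=; lia.
- apply: branching_eqmem Hin => -[r t]; rewrite mem_filter inE xpair_eqE !mem_strip.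
  case: k {Hout} => [|k]; last first.
    rewrite mem_strip /ladder /= !addSnnS.
    case: (t \in E); case: s t => -[] /=; lia.
  have -> : ((r, t) \in [seq (i.+2, t) | t <- E & t == ~~ s]) =
    [&& r == i.+2, t == ~~ s & t \in E].
    apply/mapP/and3P => [[u + [-> ->]]|[/eqP -> ts tE]].
      by rewrite mem_filter => /andP [-> ->].
    by exists t; rewrite // mem_filter ts.
  rewrite /ladder /=; case: (t \in E); case: s t => -[] /=; lia.
- apply: branching_isolated => //.
  + rewrite mem_strip; case: (s \in E); case: s {Hin Hout} => /=; lia.
  + apply/hasPn => -[r t]; rewrite mem_strip /ladder /=.
    case: (t \in E); case: s t {Hin Hout} => -[] /=; lia.
Qed.

Lemma branching_edge i t : branching ladder [:: (i, t); (i.+1, t)] 1.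
Proof.
apply: branching_vertex; first by rewrite inE xpair_eqE; lia.
  by rewrite /= /ladder /= !eqxx orbT; exact: branching_nil.
by apply: branching_isolated => //; exact: branching_nil.
Qed.

Lemma branching_single x : branching ladder [:: x] 1.
Proof. by apply: branching_isolated => //; exact: branching_nil. Qed.

(** The values satisfy L(k) = 1 + min(L(k-1), L(k-2)) with L(0) = L(1) = 1. *)
Lemma branching_strip_open i s k : branching ladder (strip i s k [::]) k.+2./2.
Proof.
have [N] := ubnP k; elim: N i s k => // N IH i s [|[|k]] kN.
- exact: branching_single.
- by apply: branching_strip_step; [exact: branching_nil | apply: branching_leq (IH _ _ _ _)].
- rewrite (_ : k.+4./2 = k.+2./2.+1) //; apply: branching_strip_step.
    by apply: IH; lia.
  by apply: branching_leq (IH _ _ _ _); lia.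
Qed.

(** Write D(k) and E(k) for the values with the two pendant vertices on the same
    and on opposite sides. Each step changes the side of one of them, so
    D(k) = 1 + min(E(k-1), E(k-2)) and E(k) = 1 + min(D(k-1), D(k-2)), starting
    from D(0) = D(1) = 1 and E(0) = E(1) = 2; both are constant on blocks of four
    consecutive values of k. *)
Lemma branching_strip_closed i s k f : branching ladder (strip i s k [:: f])
  (if s == f then 2 * ((k + 2) %/ 4) + 1 else 2 * (k %/ 4) + 2).
Proof.
have [N] := ubnP k; elim: N i s k => // N IH i s [|[|k]] kN.
- have -> : strip i s 0 [:: f] = [:: (i, s); (i.+1, f)] by rewrite /strip /= addn0.
  have [<-|sf] := eqVneq s f; first exact: branching_edge.
  apply: branching_isolated; last exact: branching_single.
    by rewrite inE xpair_eqE; lia.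
  by rewrite /= /ladder /= (negbTE sf); lia.
- apply: (@branching_leq _ _ _ (if s == f then 0 else 1).+1); first by case: ifP; lia.
  apply: branching_strip_step.
    case: s f {IH} => -[] /=;
      first [exact: branching_nil | exact: branching_single].
  by apply: branching_leq (IH _ _ _ _) => //; case: s f {IH} => -[].
- set d := (X in branching _ _ X).
  apply: (@branching_leq _ _ _ d.-1.+1); first by rewrite /d; case: ifP; lia.
  apply: branching_strip_step; apply: branching_leq (IH _ _ _ _); rewrite {}/d;
    case: s f {IH} => -[] /=; lia.
Qed.

(** The ladder on the rungs 0 .. m-1 with the last rung glued to the first: the
    prism over a cycle for tau = false, the Moebius ladder for tau = true. *)
Definition closed_ladder m (tau : bool) : rel (nat * bool) := fun x y =>
  [|| ladder x y, [&& x.1 == 0, y.1 == m.-1 & y.2 == x.2 (+) tau]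
                | [&& y.1 == 0, x.1 == m.-1 & x.2 == y.2 (+) tau]].

(** Branch on (0, false) and, without it, on (1, true). The three cases leave a
    ladder with m-3 rungs and two pendant vertices, one with m-3 rungs and a
    single pendant vertex, and one with m-2 rungs and two pendant vertices; the
    three bounds on d come from the values of these strips. In the last case the
    strip runs across the gluing. For m = 2 the first two cases leave no vertex. *)
Lemma branching_closed_ladder m tau d : 1 < m -> (m == 2) ==> tau ->
  d < m.+1./2 ->
  d < (if tau then 2 * ((m + 1) %/ 4) + 1 else 2 * ((m - 1) %/ 4) + 2) ->
  d < (if tau then 2 * (m %/ 4) + 1 else 2 * ((m - 2) %/ 4) + 2) ->
  branching (closed_ladder m tau) (rungs 0 m) d.+1.
Proof.
move=> m1 m2 d1 d2 d3.
have open s : {in s &, forall x y, closed_ladder m tau x y = ladder x y} ->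
    forall c, branching ladder s c -> branching (closed_ladder m tau) s c.
  by move=> es c /(branching_map (f := id) _ es); rewrite map_id; apply.
(* R is what remains after deleting (0, false) and (1, true) *)
pose R := (0, true) :: (1, false) :: rungs 2 (m - 2).
apply: (@branching_eqmem _ _ ((0, false) :: (1, true) :: R)).
  move=> [r t]; rewrite !inE !xpair_eqE !mem_rungs; case: t; lia.
have mR r t : ((r, t) \in R) =
    [|| (r == 0) && t, (r == 1) && ~~ t | 1 < r < m].
  by rewrite !inE !xpair_eqE mem_rungs; case: t; lia.
have mR1 r t : ((r, t) \in (1, true) :: R) =
    [|| (r == 0) && t, r == 1 | 1 < r < m].
  by rewrite in_cons mR xpair_eqE; case: t; lia.
apply: branching_vertex.
- by rewrite mR1 /=; lia.
- have [e2|m3] : m = 2 \/ 2 < m by lia.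
    have d0 : d = 0 by move: d1; rewrite e2; case: (d).
    rewrite d0; apply: (@branching_eqmem _ _ [::]); last exact: branching_nil.
    move=> [r t]; rewrite in_nil mem_filter mR1 /closed_ladder /ladder /= e2.
    move: m2; rewrite e2 /= => ->; case: t => /=; lia.
  apply: (@branching_eqmem _ _ (strip 1 true (m - 3) [:: ~~ tau])).
    move=> [r t]; rewrite mem_filter mem_strip mR1 mem_seq1.
    rewrite /closed_ladder /ladder /=; case: t tau {d2 d3 m2 open} => -[] /=; lia.
  apply: open.
    move=> [r t] [r' t']; rewrite !mem_strip !mem_seq1 /closed_ladder /=.
    case: t t' tau {d2 d3 m2} => -[] [] /=; lia.
  by apply: branching_leq (branching_strip_closed _ _ _ _); case: tau d2 {d3 m2} => /=; lia.
- apply: branching_vertex.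
  + by rewrite mR /=; lia.
  + have [e2|m3] : m = 2 \/ 2 < m by lia.
      have d0 : d = 0 by move: d1; rewrite e2; case: (d).
      rewrite d0; apply: (@branching_eqmem _ _ [::]); last exact: branching_nil.
      move=> [r t]; rewrite in_nil mem_filter mR /closed_ladder /ladder /= e2.
      move: m2; rewrite e2 /= => ->; case: t => /=; lia.
    apply: (@branching_eqmem _ _ (strip 2 false (m - 3) [::])).
      move=> [r t]; rewrite mem_filter mem_strip mR in_nil.
      rewrite /closed_ladder /ladder /=; case: t tau {d2 d3 m2 open} => -[] /=; lia.
    apply: open.
      move=> [r t] [r' t']; rewrite !mem_strip !in_nil /closed_ladder /=.
      case: t t' tau {d2 d3 m2} => -[] [] /=; lia.
    by apply: branching_leq (branching_strip_open _ _ _); move: d1; lia.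
  (* the strip on the rungs 1 .. m, whose rung m is the rung 0 seen through the
     gluing *)
  + pose f (x : nat * bool) := if x.1 == m then (0, x.2 (+) tau) else x.
    apply: (@branching_eqmem _ _ (map f (strip 1 false (m - 2) [:: ~~ tau]))).
      move=> [r t]; rewrite mR; apply/mapP/idP => [[[r' t']]|].
        rewrite mem_strip mem_seq1 /f /=; case: (r' =P m) => [->|r'm] + [-> ->].
          case: t' tau {d2 d3 m2 open f} => -[] /=; lia.
        case: t' tau {d2 d3 m2 open f} => -[] /=; lia.
      have [->|r0] := eqVneq r 0.
        case: t => //= _; exists (m, ~~ tau); last by rewrite /f /= eqxx; case: tau {d2 d3 m2 open f}.
        by rewrite mem_strip mem_seq1 eqxx; lia.
      move=> rt; exists (r, t); last by rewrite /f /=; case: (r =P m) => // e; move: rt; lia.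
      by rewrite mem_strip mem_seq1; case: t rt => /=; lia.
    apply: (@branching_map _ _ ladder).
    * move=> [r t] [r' t']; rewrite !mem_strip !mem_seq1 /f /=.
      case: (r =P m) => rm; case: (r' =P m) => r'm.
      + by rewrite rm r'm => _ _ [/addIb ->].
      + by move=> _ + [r'0 _]; lia.
      + by move=> + _ [r0 _]; lia.
      + by [].
    * move=> [r t] [r' t']; rewrite !mem_strip !mem_seq1 /f /=.
      case: (r =P m) => rm; case: (r' =P m) => r'm; rewrite /closed_ladder /ladder /=;
      case: t t' tau {d2 d3 m2 open f} => -[] [] /=; lia.
    * by apply: branching_leq (branching_strip_closed _ _ _ _); case: tau d3 {d2 m2 open f} => /=; lia.
Qed.

End Ladder.

(** * Cubic circulant graphs as unions of closed ladders *)

Section Circulant.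

Lemma branching_flatten (T : eqType) (e : rel T) (I : eqType) (F : I -> seq T) cs d :
  uniq cs -> (forall c, c \in cs -> branching e (F c) d) ->
  (forall b c x y, b \in cs -> c \in cs -> b != c -> x \in F b -> y \in F c ->
     (x != y) && ~~ e x y) ->
  branching e (flatten [seq F c | c <- cs]) (size cs * d).
Proof.
elim: cs => [|b cs IH] /=; first by move=> *; exact: branching_nil.
move=> /andP [bcs ucs] Fd sep.
rewrite mulSn; apply: branching_cat.
- move=> x y xb /flatten_mapP [c ccs yc]; apply: (sep b c) => //.
  + exact: mem_head.
  + by rewrite inE ccs orbT.
  + by apply: contraNneq bcs => ->.
- by apply: Fd; exact: mem_head.
- apply: IH => // [c ccs|b' c x y b'cs ccs].
    by apply: Fd; rewrite inE ccs orbT.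
  by apply: sep; rewrite inE ?b'cs ?ccs orbT.
Qed.

Lemma circulant_adjE n a (i j : 'I_(2 * n)) : 0 < a < n ->
  circulant (2 * n) [:: a; n] i j =
  [|| i + a == j %[mod 2 * n], j + a == i %[mod 2 * n] | i + n == j %[mod 2 * n]].
Proof.
move=> /andP [a0 an]; have an' := ltnW an; rewrite /= /circulant_adj -val_eqE /= !inE.
have small (x b : nat) : x < 2 * n -> b <= n ->
    (x + b) %% (2 * n) = if x + b < 2 * n then x + b else x + b - 2 * n.
  move=> xn bn; case: ltnP => h; first by rewrite modn_small.
  by rewrite -{1}(subnK h) modnDr modn_small //; lia.
have := ltn_ord i; have := ltn_ord j; move: (nat_of_ord i) (nat_of_ord j) => {}i {}j jn iN.
rewrite !small ?(modn_small jn) ?(modn_small iN) //.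
do 3!case: ltnP => ?; lia.
Qed.

(** Reduction modulo m, where A is invertible, shows that r and r' agree or are 0
    and m; in the latter case the sides differ by A * m modulo 2 * m, that is, by
    the parity of A. This is the twist of the gluing. *)
Lemma twisted_eq_mod A m r s r' s' : coprime A m -> 1 < m -> r <= m -> r' <= m ->
  (A * r + m * nat_of_bool s == A * r' + m * nat_of_bool s' %[mod 2 * m]) =
  [|| (r == r') && (s == s'), [&& r == 0, r' == m & s == s' (+) odd A] |
     [&& r' == 0, r == m & s' == s (+) odd A]].
Proof.
move=> cA m1; wlog rr : r s r' s' / r <= r' => [H rm r'm|rm r'm].
  have [/H -> //|/ltnW r'r] := leqP r r'; rewrite eq_sym H // (eq_sym r' r) (eq_sym s' s).
  by congr (_ || _); rewrite orbC.
have parity x y : (m * x == m * y %[mod 2 * m]) = (odd x == odd y).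
  by rewrite [2 * m]mulnC -!muln_modr eqn_pmul2l ?modn2 ?eqb_odd //; lia.
have [<-|ne] := eqVneq r r'.
  rewrite eqn_modDl parity !oddb /=; case: (s == s') => //=; lia.
have [/andP [/eqP -> /eqP ->]|h] := boolP ((r == 0) && (r' == m)).
  rewrite muln0 add0n (mulnC A) -mulnDr parity oddD !oddb eqxx /=.
  by rewrite addbC; case: (s == _) => //=; lia.
transitivity false; last by lia.
apply: contraNF h => /eqP /(congr1 (modn^~ m)).
rewrite !modn_dvdm ?dvdn_mull // ![_ + m * _]addnC !(mulnC m) !modnMDl => /eqP.
rewrite eq_sym eqn_mod_dvd ?leq_mul2l ?rr ?orbT // -mulnBr Gauss_dvdr 1?coprime_sym //.
by move=> /dvdn_leq; lia.
Qed.

(** Adjacency in the shape produced by [vertex_eq_mod] for the three translates. *)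
Lemma closed_ladderE m tau r s r' s' : r < m -> r' < m ->
  closed_ladder m tau (r, s) (r', s') =
  [|| [|| (r.+1 == r') && (s == s'), [&& r.+1 == 0, r' == m & s == s' (+) tau] |
        [&& r' == 0, r.+1 == m & s' == s (+) tau]],
      [|| (r'.+1 == r) && (s' == s), [&& r'.+1 == 0, r == m & s' == s (+) tau] |
        [&& r == 0, r'.+1 == m & s == s' (+) tau]]
    | [|| (r == r') && (~~ s == s'), [&& r == 0, r' == m & ~~ s == s' (+) tau] |
        [&& r' == 0, r == m & s' == ~~ s (+) tau]]].
Proof.
by move=> rm r'm; rewrite /closed_ladder /ladder /=; case: s s' tau => -[] [] /=; lia.
Qed.

Variables (n a : nat).
Hypotheses (a0 : 0 < a) (an : a < n).
Local Notation g := (gcdn a n).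
Local Notation m := (n %/ g).
Local Notation tau := (odd (a %/ g)).

Let g0 : 0 < g. Proof. by rewrite gcdn_gt0 a0. Qed.
Let nE : n = m * g. Proof. by rewrite divnK // dvdn_gcdr. Qed.
Let aE : a = (a %/ g) * g. Proof. by rewrite divnK // dvdn_gcdl. Qed.
Let m1 : 1 < m.
Proof.
rewrite ltn_divRL ?dvdn_gcdr // mul1n.
by apply: leq_ltn_trans an; rewrite dvdn_leq // dvdn_gcdl.
Qed.
Let cop : coprime (a %/ g) m.
Proof.
rewrite /coprime -(eqn_pmul2r g0) mul1n muln_gcdl -aE -nE; exact: eqxx.
Qed.

Definition vertex c (x : nat * bool) := c + a * x.1 + n * x.2.

(** As g divides a, n and 2 * n, reduction modulo g recovers c; the rest is
    [twisted_eq_mod] after division by g. The value m is allowed for r and r' so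
    that the neighbour r + 1 of the last rung is covered. *)
Lemma vertex_eq_mod c c' r s r' s' : c < g -> c' < g -> r <= m -> r' <= m ->
  (vertex c (r, s) == vertex c' (r', s') %[mod 2 * n]) =
  (c == c') && [|| (r == r') && (s == s'),
     [&& r == 0, r' == m & s == s' (+) tau] |
     [&& r' == 0, r == m & s' == s (+) tau]].
Proof.
move=> cg c'g rm r'm; rewrite /vertex /=.
have E b (t : bool) : a * b + n * t = (a %/ g * b + m * t) * g.
  by rewrite mulnDl mulnAC -aE mulnAC -nE.
have [<-|cc] := eqVneq c c'; last first.
  apply: contraNF cc => /eqP /(congr1 (modn^~ g)).
  rewrite !modn_dvdm ?dvdn_mull ?dvdn_gcdr // -!addnA !E ![_ + _ * g]addnC !modnMDl.
  by rewrite !modn_small // => ->.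
have -> : 2 * n = 2 * m * g by rewrite -mulnA -nE.
rewrite -!addnA eqn_modDl !E -!muln_modl eqn_pmul2r //.
exact: twisted_eq_mod.
Qed.

(** The neighbours of a vertex of a cubic circulant graph are its translates by a,
    - a and n: the steps along the two sides of the ladder, and the rung. *)
Lemma vertex_adj c c' x x' : c < g -> c' < g -> x.1 < m -> x'.1 < m ->
  [|| vertex c x + a == vertex c' x' %[mod 2 * n],
      vertex c' x' + a == vertex c x %[mod 2 * n]
    | vertex c x + n == vertex c' x' %[mod 2 * n]] =
  (c == c') && closed_ladder m tau x x'.
Proof.
case: x x' => r s [r' s'] /= cg c'g rm r'm.
have Sa b k (t : bool) : vertex b (k, t) + a = vertex b (k.+1, t).
  by rewrite /vertex /= mulnS; lia.
have -> : (vertex c (r, s) + n == vertex c' (r', s') %[mod 2 * n]) =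
          (vertex c (r, ~~ s) == vertex c' (r', s') %[mod 2 * n]).
  congr (_ == _); rewrite /vertex /=; case: s => /=; rewrite ?muln0 ?muln1 ?addn0 //.
  by rewrite -addnA -[n + n]/(n + n) addnn -mul2n modnDr.
have [rm' r'm'] := (ltnW rm, ltnW r'm).
rewrite !Sa (vertex_eq_mod _ _ cg c'g rm r'm') (vertex_eq_mod _ _ c'g cg r'm rm').
rewrite (vertex_eq_mod _ _ cg c'g rm' r'm') closed_ladderE //.
by rewrite (eq_sym c' c); case: (c == c').
Qed.

Hypothesis n2 : 0 < 2 * n.

Definition circ_vertex c x : 'I_(2 * n) := Ordinal (ltn_pmod (vertex c x) n2).

Lemma circ_vertex_adj c c' x x' : c < g -> c' < g -> x.1 < m -> x'.1 < m ->
  circulant (2 * n) [:: a; n] (circ_vertex c x) (circ_vertex c' x') =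
  (c == c') && closed_ladder m tau x x'.
Proof.
move=> cg c'g xm x'm; rewrite -vertex_adj // circulant_adjE ?a0 //=.
by rewrite !modnDml !modn_mod.
Qed.

Lemma circ_vertex_inj c c' x x' : c < g -> c' < g -> x.1 < m -> x'.1 < m ->
  circ_vertex c x = circ_vertex c' x' -> (c, x) = (c', x').
Proof.
case: x x' => r s [r' s'] /= cg c'g xm x'm /(congr1 val) /= /eqP.
rewrite (vertex_eq_mod _ _ cg c'g (ltnW xm) (ltnW x'm)) => /andP [/eqP -> H].
have {H} /andP [/eqP -> /eqP -> //] : (r == r') && (s == s').
by move: H xm x'm; case: (s == s'); lia.
Qed.

Lemma uniq_rungs i k : uniq (rungs i k).
Proof.
apply: allpairs_uniq => //; first exact: iota_uniq.
by move=> [? ?] [? ?] _ _.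
Qed.

Lemma rungs_lt x : x \in rungs 0 m -> x.1 < m.
Proof. by case: x => r t; rewrite mem_rungs. Qed.

(** The g * (2 * m) labels give distinct vertices, and 2 * n = g * (2 * m). *)
Lemma enum_circ_vertex :
  [seq circ_vertex c x | c <- iota 0 g, x <- rungs 0 m] =i enum 'I_(2 * n).
Proof.
set s := (X in X =i _).
have us : uniq s.
  apply: allpairs_uniq; [exact: iota_uniq|exact: uniq_rungs|].
  move=> [c x] [c' x'] /allpairsP [[? ?] [/= cg xm [-> ->]]].
  move=> /allpairsP [[? ?] [/= c'g x'm [-> ->]]] /=.
  rewrite !mem_iota in cg c'g; move/rungs_lt: xm => xm; move/rungs_lt: x'm => x'm.
  exact: circ_vertex_inj.
apply: (uniq_min_size us _ _).2 => [x _|]; first by rewrite mem_enum.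
rewrite !size_allpairs !size_iota -cardE card_ord /=.
by rewrite mulnA (mulnC g) -nE mulnC.
Qed.

Lemma branching_circulant d :
  branching (closed_ladder m tau) (rungs 0 m) d ->
  branching (circulant (2 * n) [:: a; n]) (enum 'I_(2 * n)) (g * d).
Proof.
move=> Hd; apply: (@branching_eqmem _ _ _ _ _ enum_circ_vertex).
rewrite -[X in X * d](size_iota 0 g).
apply: branching_flatten; first exact: iota_uniq.
  move=> c; rewrite mem_iota => cg.
  apply: branching_map Hd => x y /rungs_lt xm /rungs_lt ym.
    by move/(circ_vertex_inj cg cg xm ym) => [].
  by rewrite circ_vertex_adj // eqxx.
move=> b c u v; rewrite !mem_iota => bg cg bc /mapP [x /rungs_lt xm ->] /mapP [y /rungs_lt ym ->].
rewrite circ_vertex_adj // (negbTE bc) andbT.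
by apply: contra bc => /eqP /(circ_vertex_inj bg cg xm ym) [->].
Qed.

End Circulant.

(** * Stanley depth of cubic circulant graphs *)

Lemma sdepth_circulant (K : fieldType) n a d : 0 < a < n ->
  let g := gcdn a n in let m := n %/ g in
  d < m.+1./2 ->
  d < (if odd (a %/ g) then minn (2 * ((m + 1) %/ 4) + 1) (2 * (m %/ 4) + 1)
       else minn (2 * ((m - 1) %/ 4) + 2) (2 * ((m - 2) %/ 4) + 2)) ->
  (m == 2) ==> odd (a %/ g) ->
  g * d.+1 <= sdepth (edge_quotient K (circulant (2 * n) [:: a; n])).
Proof.
move=> /andP [a0 an] g m d1 d2 m2.
have gn : m * g = n by rewrite divnK // dvdn_gcdr.
have m1 : 1 < m.
  rewrite ltn_divRL ?dvdn_gcdr // mul1n.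
  by apply: leq_ltn_trans an; rewrite dvdn_leq // dvdn_gcdl.
apply: branching_sdepth.
  rewrite -gn mulnA mulnC leq_mul2r; apply/orP; right.
  by move: (m) d1 => k; clear; lia.
apply: branching_circulant => //; first by lia.
move: d2 m2; rewrite -/g -/m; move: (odd _) (m) d1 m1 => tau k d1 k1 d2 k2.
apply: branching_closed_ladder => //; case: tau d2 {k2}; clear; lia.
Qed.

(** Here t divides n, and a / t is odd because otherwise 2 * t would divide both
    2 * n and a: the components are t Moebius ladders. *)
Lemma gcd_even n a : 0 < a -> 0 < n -> ~~ odd ((2 * n) %/ gcdn (2 * n) a) ->
  gcdn a n = gcdn (2 * n) a /\ odd (a %/ gcdn (2 * n) a).
Proof.
move=> a0 n0; set t := gcdn (2 * n) a => ev.
have t0 : 0 < t by rewrite gcdn_gt0 a0 orbT.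
have e : 2 * n = ((2 * n) %/ t) * t by rewrite divnK // dvdn_gcdl.
have tn : t %| n.
  apply/dvdnP; exists ((2 * n) %/ t)./2.
  apply/eqP; rewrite -(eqn_pmul2l (ltn0Sn 1)) {1}e mulnA (mul2n _./2).
  by rewrite even_halfK.
split.
  apply/eqP; rewrite eqn_dvd [X in _ && X]dvdn_gcd tn dvdn_gcdr !andbT.
  by rewrite dvdn_gcd dvdn_gcdl dvdn_mull ?dvdn_gcdr.
apply/negPn/negP => oa.
have : t * 2 %| t.
  rewrite {2}/t dvdn_gcd (mulnC 2) dvdn_pmul2r // tn /=.
  rewrite -(divnK (dvdn_gcdr (2 * n) a)) -/t mulnC dvdn_pmul2r //.
  by rewrite dvdn2.
by rewrite -{2}(muln1 t) dvdn_pmul2l.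
Qed.

(** Here t contains every factor 2 of 2 * n, so it is even and a / t is prime to the
    odd number 2 * n / t: the components are t / 2 prisms over an odd cycle. *)
Lemma gcd_odd n a : 0 < a -> 0 < n -> odd ((2 * n) %/ gcdn (2 * n) a) ->
  [/\ gcdn (2 * n) a = 2 * gcdn a n, (2 * n) %/ gcdn (2 * n) a = n %/ gcdn a n
    & ~~ odd (a %/ gcdn a n)].
Proof.
move=> a0 n0; set t := gcdn (2 * n) a => od.
have t0 : 0 < t by rewrite gcdn_gt0 a0 orbT.
have e : (2 * n) %/ t * t = 2 * n by rewrite divnK // dvdn_gcdl.
have b : a %/ t * t = a by rewrite divnK // dvdn_gcdr.
have t2 : t = 2 * t./2.
  have := odd_double_half t; have := congr1 odd e.
  by rewrite !oddM od /= mul2n => ->.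
have cp : coprime ((2 * n) %/ t) (a %/ t).
  by rewrite /coprime -(eqn_pmul2r t0) mul1n muln_gcdl e b.
have nE : n = (2 * n) %/ t * t./2.
  by apply/eqP; rewrite -(eqn_pmul2l (ltn0Sn 1)) mulnCA -t2 e.
have aE : a = 2 * (a %/ t) * t./2 by rewrite -mulnA mulnCA -t2 b.
have gE : gcdn a n = t./2.
  rewrite {1}nE {1}aE -muln_gcdl (eqP (_ : coprime _ _)) ?mul1n //.
  by rewrite coprimeMl coprime2n od coprime_sym.
have h0 : 0 < t./2 by rewrite -gE gcdn_gt0 a0.
rewrite gE; split=> //; first by rewrite {2}nE mulnK.
by rewrite {1}aE mulnK // oddM.
Qed.

Import Order.TTheory GRing.Theory Num.Theory.

(** All the bounds have the form of a ceiling times the number of components; it is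
    enough to bound the argument of the ceiling by a natural number. *)
Lemma ceil_mul_le (x c : rat) (k s : nat) :
  (x <= k%:R -> 0 <= c -> k%:R * c <= s%:R -> (Num.ceil x)%:~R * c <= s%:R)%R.
Proof.
move=> xk c0 /(le_trans _); apply; rewrite ler_wpM2r //.
by rewrite pmulrn ler_int ceil_le_int -pmulrn.
Qed.

Unset Implicit Arguments.
Local Open Scope ring_scope.

Theorem theorem4p11 (K : fieldType) (n a : nat)
    (hn : (2 <= n)%N) (ha : (1 <= a < n)%N) :
  let t := gcdn (2 * n) a in
  let G : sgraph (2 * n) := circulant (2 * n) [:: a; n] in
  let sd : rat := (sdepth (edge_quotient K G))%:R in
  let n' : rat := n%:R in
  let t' : rat := t%:R in
  (~~ odd ((2 * n) %/ t) ->
     sd >= if n %/ t == 1 %[mod 4]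
           then (Num.ceil (n' / (2 * t')))%:~R * t'
           else (Num.ceil ((n' - t') / (2 * t')))%:~R * t')
  /\
  (odd ((2 * n) %/ t) ->
     (((2 * n) %/ t)%N = 1 %[mod 4] ->
        sd >= (Num.ceil ((2 * n' - t') / (2 * t')))%:~R * (t' / 2))
     /\
     (((2 * n) %/ t)%N = 3 %[mod 4] ->
        sd >= (Num.ceil (n' / t'))%:~R * (t' / 2))).
Proof.
move=> t G sd n' t'; case/andP: (ha) => a0 an.
have n0 : (0 < n)%N by lia.
have t0 : (0 < t)%N by rewrite gcdn_gt0 a0 orbT.
have t'0 : 0 < t' by rewrite ltr0n.
split=> [/(gcd_even a0 n0)|/(gcd_odd a0 n0)]; rewrite -/t.
- move=> [gt_ oda].
  have nE : (n %/ t * t = n)%N by rewrite divnK // -gt_ dvdn_gcdr.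
  have m1 : (1 < n %/ t)%N.
    by rewrite ltn_divRL ?mul1n -gt_ ?dvdn_gcdr // (leq_ltn_trans _ an) // dvdn_leq // dvdn_gcdl.
  have n'E : n' = (n %/ t)%:R * t' by rewrite -natrM nE.
  have /= := @sdepth_circulant K n a _ ha; rewrite gt_ oda implybT.
  rewrite -/G; move: (n %/ t)%N m1 n'E {nE} => m m1 n'E H.
  (* H speaks of the successor of a number, as the value of a closed ladder is
     positive; hence the predecessors below *)
  case: ifP => m4.
    apply: (@ceil_mul_le _ _ (m.+1)./2); last 1 first.
    + rewrite -natrM ler_nat mulnC.
      rewrite (_ : m.+1./2 = m.-1./2.+1); last by lia.
      by apply: H => //; lia.
    + have -> : n' / (2 * t') = m%:R / 2 by rewrite n'E; field; rewrite ?lt0r_neq0.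
      rewrite ler_pdivrMr // -natrM ler_nat; lia.
    + exact: ltW.
  apply: (@ceil_mul_le _ _ m./2); last 1 first.
  + rewrite -natrM ler_nat mulnC.
    rewrite (_ : m./2 = m./2.-1.+1); last by lia.
    by apply: H => //; lia.
  + have -> : (n' - t') / (2 * t') = (m%:R - 1) / 2 by rewrite n'E; field; rewrite ?lt0r_neq0.
    rewrite ler_pdivrMr // lerBlDr -natrM natr1 ler_nat; lia.
  + exact: ltW.
- move=> [tE mE oda].
  have g0 : (0 < gcdn a n)%N by rewrite gcdn_gt0 a0.
  have nE : (n %/ gcdn a n * gcdn a n = n)%N by rewrite divnK // dvdn_gcdr.
  have m1 : (1 < n %/ gcdn a n)%N.
    by rewrite ltn_divRL ?mul1n ?dvdn_gcdr // (leq_ltn_trans _ an) // dvdn_leq // dvdn_gcdl.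
  have n'E : n' = (n %/ gcdn a n)%:R * (gcdn a n)%:R by rewrite -natrM nE.
  have t'E : t' = 2 * (gcdn a n)%:R by rewrite -natrM -tE.
  have g'0 : (0 : rat) < (gcdn a n)%:R by rewrite ltr0n.
  have /= := @sdepth_circulant K n a _ ha; rewrite (negbTE oda) mE -/G t'E n'E.
  move: (n %/ gcdn a n)%N m1 {nE mE n'E t'E} => m m1 H.
  have half : 2 * (gcdn a n)%:R / 2 = (gcdn a n)%:R :> rat by field.
  rewrite half; split=> m4.
    apply: (@ceil_mul_le _ _ m./2); last 1 first.
    + rewrite -natrM ler_nat mulnC.
      rewrite (_ : m./2 = m./2.-1.+1); last by lia.
      by apply: H => //; lia.
    + rewrite (_ : _ / _ = (m%:R - 1) / 2); last by field; rewrite ?lt0r_neq0.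
      rewrite ler_pdivrMr // lerBlDr -natrM natr1 ler_nat; lia.
    + exact: ltW.
  apply: (@ceil_mul_le _ _ m.+1./2); last 1 first.
  + rewrite -natrM ler_nat mulnC.
    rewrite (_ : m.+1./2 = m.-1./2.+1); last by lia.
    by apply: H => //; lia.
  + rewrite (_ : _ / _ = m%:R / 2); last by field; rewrite ?lt0r_neq0.
    rewrite ler_pdivrMr // -natrM ler_nat; lia.
  + exact: ltW.
Qed.
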